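(* In the category $\mathsf{Mon}$ of monoids, every Mal'tsev object is a group. In other words, if $M$ is a monoid such that the category $\mathrm{Pt}_M(\mathsf{Mon})$ of points over $M$ is unital, then $M$ is a group.
   Context: In a category with finite limits $\mathcal{C}$, a pair of morphisms with common codomain $A$ is jointly strongly epimorphic if every monomorphism into $A$ through which both factor is an isomorphism. A point over $Y$ is a pair $(f\colon A\to Y,\ s\colon Y\to A)$ with $fs=1_Y$; $\mathrm{Pt}_Y(\mathcal{C})$ is the category of points over $Y$, whose morphisms $(f,s)\to(f',s')$ are the morphisms $x\colon A\to A'$ with $f'x=f$ and $xs=s'$. A pointed finitely complete category is unital if for all objects $X,Y$ the product inclusions $\langle 1_X,0\rangle\colon X\to X\times Y$ and $\langle 0,1_Y\rangle\colon Y\to X\times Y$ are jointly strongly epimorphic. An object $Y$ of $\mathcal{C}$ is a Mal'tsev object if $\mathrm{Pt}_Y(\mathcal{C})$ is unital; explicitly, for every two points $(f\colon A\to Y,s)$ and $(g\colon C\to Y,t)$ over $Y$, the morphisms $\langle 1_A,tf\rangle\colon A\to A\times_YC$ and $\langle sg,1_C\rangle\colon C\to A\times_YC$ are jointly strongly epimorphic in $\mathcal{C}$. *)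

(* Defs.v *)
From HB Require Import structures.
From mathcomp Require Import all_boot.
From mathcomp Require Import boolp.

Set Implicit Arguments.
Unset Strict Implicit.
Unset Printing Implicit Defensive.

Local Open Scope group_scope.

Reserved Notation "g \co f" (at level 50, format "g  \co  f").

Record category := Category {
  ob :> Type;
  hom : ob -> ob -> Type;
  idm : forall a, hom a a;
  comp : forall a b c, hom b c -> hom a b -> hom a c;
  comp_idl : forall a b (f : hom a b), comp (idm b) f = f;
  comp_idr : forall a b (f : hom a b), comp f (idm a) = f;
  comp_assoc : forall a b c d (h : hom c d) (g : hom b c) (f : hom a b),
    comp h (comp g f) = comp (comp h g) f
}.
Arguments hom {C} a b : rename.
Arguments idm {C} a : rename.
Arguments comp {C a b c} g f : rename.

Notation "g \co f" := (comp g f).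

Section Notions.
Variable C : category.

Definition is_mono (a b : C) (m : hom a b) : Prop :=
  forall (x : C) (g h : hom x a), m \co g = m \co h -> g = h.

Definition is_iso (a b : C) (f : hom a b) : Prop :=
  exists g : hom b a, g \co f = idm a /\ f \co g = idm b.

Definition jointly_strongly_epic (a b c : C) (f : hom a c) (g : hom b c) :
    Prop :=
  forall (s : C) (m : hom s c), is_mono m ->
    (exists f' : hom a s, m \co f' = f) ->
    (exists g' : hom b s, m \co g' = g) -> is_iso m.

Definition is_initial (z : C) : Prop := forall x : C, exists! f : hom z x, True.
Definition is_terminal (z : C) : Prop := forall x : C, exists! f : hom x z, True.
Definition is_zero (z : C) : Prop := is_initial z /\ is_terminal z.
Definition pointed : Prop := exists z : C, is_zero z.

Definition is_zero_hom (a b : C) (f : hom a b) : Prop :=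
  exists z : C, is_zero z /\ exists (g : hom a z) (h : hom z b), f = h \co g.

Definition is_product (x y p : C) (p1 : hom p x) (p2 : hom p y) : Prop :=
  forall (t : C) (f : hom t x) (g : hom t y),
    exists! u : hom t p, p1 \co u = f /\ p2 \co u = g.

End Notions.

Record functor (J C : category) := Functor {
  fobj :> J -> C;
  fmap : forall i j : J, hom i j -> hom (fobj i) (fobj j);
  fmap_id : forall i : J, fmap (idm i) = idm (fobj i);
  fmap_comp : forall (i j k : J) (v : hom j k) (u : hom i j),
    fmap (v \co u) = fmap v \co fmap u
}.

Section Limits.
Variables (J C : category) (D : functor J C).

Definition is_cone (x : C) (p : forall j : J, hom x (D j)) : Prop :=
  forall (i j : J) (u : hom i j), fmap D u \co p i = p j.

Definition is_limit (l : C) (p : forall j : J, hom l (D j)) : Prop :=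
  is_cone p /\
  forall (x : C) (q : forall j : J, hom x (D j)), is_cone q ->
    exists! u : hom x l, forall j : J, p j \co u = q j.

End Limits.

(* Not [finite_set [set: T]]: its universe constraints would exclude [Mon] from *)
(* [category].                                                                *)
Definition finite_type (T : Type) : Prop :=
  exists (n : nat) (e : 'I_n -> T), forall x : T, exists i : 'I_n, e i = x.

Definition finite_category (J : category) : Prop :=
  finite_type J /\ forall i j : J, finite_type (hom i j).

Definition finitely_complete (C : category) : Prop :=
  forall (J : category) (D : functor J C), finite_category J ->
    exists (l : C) (p : forall j : J, hom l (D j)), is_limit p.

(* [i1] and [i2] below are forced to be <1_X, 0> and <0, 1_Y>. *)
Definition unital (C : category) : Prop :=
  [/\ pointed C, finitely_complete C &
    forall (X Y P : C) (p1 : hom P X) (p2 : hom P Y), is_product p1 p2 ->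
    forall (i1 : hom X P) (i2 : hom Y P),
      p1 \co i1 = idm X -> is_zero_hom (p2 \co i1) ->
      is_zero_hom (p1 \co i2) -> p2 \co i2 = idm Y ->
      jointly_strongly_epic i1 i2].

Section Points.
Variables (C : category) (Y : C).

Record point := Point {
  pt_ob : C;
  pt_map : hom pt_ob Y;
  pt_sec : hom Y pt_ob;
  pt_mapK : pt_map \co pt_sec = idm Y
}.

Record point_hom (p q : point) := PointHom {
  ph_hom : hom (pt_ob p) (pt_ob q);
  ph_map : pt_map q \co ph_hom = pt_map p;
  ph_sec : ph_hom \co pt_sec p = pt_sec q
}.

Lemma point_hom_inj (p q : point) : injective (@ph_hom p q).
Proof.
move=> [x x1 x2] [y y1 y2] /= exy; case: _ / exy y1 y2 => y1 y2.
by rewrite (Prop_irrelevance x1 y1) (Prop_irrelevance x2 y2).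
Qed.

Definition pt_id (p : point) : point_hom p p :=
  PointHom (comp_idr (pt_map p)) (comp_idl (pt_sec p)).

Lemma pt_comp_map (p q r : point) (g : point_hom q r) (f : point_hom p q) :
  pt_map r \co (ph_hom g \co ph_hom f) = pt_map p.
Proof. by rewrite comp_assoc !ph_map. Qed.

Lemma pt_comp_sec (p q r : point) (g : point_hom q r) (f : point_hom p q) :
  ph_hom g \co ph_hom f \co pt_sec p = pt_sec r.
Proof. by rewrite -comp_assoc !ph_sec. Qed.

Definition pt_comp (p q r : point) (g : point_hom q r) (f : point_hom p q) :
  point_hom p r := PointHom (pt_comp_map g f) (pt_comp_sec g f).

Lemma pt_comp_idl (p q : point) (f : point_hom p q) : pt_comp (pt_id q) f = f.
Proof. exact/point_hom_inj/comp_idl. Qed.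

Lemma pt_comp_idr (p q : point) (f : point_hom p q) : pt_comp f (pt_id p) = f.
Proof. exact/point_hom_inj/comp_idr. Qed.

Lemma pt_comp_assoc (p q r s : point) (h : point_hom r s) (g : point_hom q r)
    (f : point_hom p q) :
  pt_comp h (pt_comp g f) = pt_comp (pt_comp h g) f.
Proof. exact/point_hom_inj/comp_assoc. Qed.

Definition Pt : category := Category pt_comp_idl pt_comp_idr pt_comp_assoc.

End Points.

Definition maltsev_object (C : category) (Y : C) : Prop := unital (Pt Y).

Lemma monoid_hom_ext (A B : monoidType) (f g : UMagmaMorphism.type A B) :
  f =1 g -> f = g.
Proof.
case: f => f [[f1] [fM]]; case: g => g [[g1] [gM]] /= /funext fg.
case: _ / fg g1 gM => g1 gM.
by rewrite (Prop_irrelevance f1 g1) (Prop_irrelevance fM gM).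
Qed.

Definition monoid_id (A : monoidType) : UMagmaMorphism.type A A := idfun.

Definition monoid_comp (A B C : monoidType) (g : UMagmaMorphism.type B C)
  (f : UMagmaMorphism.type A B) : UMagmaMorphism.type A C := g \o f.

Lemma monoid_comp_idl (A B : monoidType) (f : UMagmaMorphism.type A B) :
  monoid_comp (monoid_id B) f = f.
Proof. exact: monoid_hom_ext. Qed.

Lemma monoid_comp_idr (A B : monoidType) (f : UMagmaMorphism.type A B) :
  monoid_comp f (monoid_id A) = f.
Proof. exact: monoid_hom_ext. Qed.

Lemma monoid_comp_assoc (A B C D : monoidType) (h : UMagmaMorphism.type C D)
    (g : UMagmaMorphism.type B C) (f : UMagmaMorphism.type A B) :
  monoid_comp h (monoid_comp g f) = monoid_comp (monoid_comp h g) f.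
Proof. exact: monoid_hom_ext. Qed.

(* Carriers of a [monoidType] have a choice structure; classically every type *)
(* has one, so this is the category of all monoids.                           *)
Definition Mon : category :=
  Category monoid_comp_idl monoid_comp_idr monoid_comp_assoc.

Definition is_group (M : monoidType) : Prop :=
  exists inv : M -> M, left_inverse 1 inv *%g /\ right_inverse 1 inv *%g.

(* Main.v *)
(* Let W be the monoid obtained from the coproduct of M with the free monoid on
   a letter x by identifying any two words with at least two occurrences of x
   that have the same value under the evaluation x |-> m.  Evaluation and the
   inclusion of M make W a point over M.  If Pt_M(Mon) is unital, every element
   of W x_M W is a product of elements (a, ev a) and (ev b, b).  For (x, x) such
   a product contains exactly one factor (u x v, u m v) and exactly one factor
   (w m z, w x z), so that, for instance, (x, x) = (u x v w m z, u m v w x z),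
   which forces u = z = 1, v w m = 1 and m v w = 1. *)
Require Import Defs.
From HB Require Import structures.
From mathcomp Require Import all_boot.
From mathcomp Require Import boolp.

Set Implicit Arguments.
Unset Strict Implicit.
Unset Printing Implicit Defensive.

Local Open Scope group_scope.

(** The closure proof is an argument of the type, so that the monoid structure can be inferred from
    the type alone. *)
Definition submonoid (G : monoidType) (D : pred G) (_ : monoid_closed D) :=
  {x : G | D x}.

Section Submonoid.
Variables (G : monoidType) (D : pred G) (closedD : monoid_closed D).
HB.instance Definition _ := SubChoice.on (submonoid closedD).
HB.instance Definition _ :=
  SubChoice_isSubMonoid.Build G D (submonoid closedD) closedD.
End Submonoid.

Definition monoid_hom (A B : monoidType) (f : A -> B) (fM : monoid_morphism f) :
  UMagmaMorphism.type A B := HB.pack f (isUMagmaMorphism.Build A B f fM).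

Lemma pair_morphism (A B C : monoidType) (f : UMagmaMorphism.type A B)
    (g : UMagmaMorphism.type A C) : monoid_morphism (fun a => (f a, g a)).
Proof. by split=> [|a b]; rewrite ?gmulf1 ?gmulfM. Qed.

Definition pair_hom (A B C : monoidType) (f : UMagmaMorphism.type A B)
    (g : UMagmaMorphism.type A C) : UMagmaMorphism.type A (B * C)%type :=
  monoid_hom (pair_morphism f g).

Lemma lift_morphism (A G : monoidType) (D : pred G) (closedD : monoid_closed D)
    (f : UMagmaMorphism.type A G) (fD : forall a, D (f a)) :
  monoid_morphism (fun a => exist _ (f a) (fD a) : submonoid closedD).
Proof.
by split=> [|a b]; apply: val_inj; rewrite ?gmulf1 ?gmulfM /= ?gmulf1 ?gmulfM.
Qed.

Definition lift_hom (A G : monoidType) (D : pred G) (closedD : monoid_closed D)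
    (f : UMagmaMorphism.type A G) (fD : forall a, D (f a)) :
  UMagmaMorphism.type A (submonoid closedD) :=
  monoid_hom (lift_morphism closedD fD).

Lemma monoid_hom_congr (A B : monoidType) (f g : UMagmaMorphism.type A B) :
  f = g -> f =1 g.
Proof. by move->. Qed.

(** The identity point on [M] is a zero object of [Pt M]: the only morphism from it to [q] is the
    section of [q], and the only one from [p] to it is the map of [p]. *)
Lemma is_zero_hom_section (M : monoidType) (p q : Pt (M : Mon))
    (h : hom p q) :
  (forall a, ph_hom h a = pt_sec q (pt_map p a)) -> is_zero_hom h.
Proof.
move=> hE.
pose z : Pt (M : Mon) := Point (comp_idl (idm (M : Mon))).
have zE (r : Pt (M : Mon)) (k : hom z r) : ph_hom k = pt_sec r.
  by rewrite -(ph_sec k); symmetry; apply: comp_idr.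
have zE' (r : Pt (M : Mon)) (k : hom r z) : ph_hom k = pt_map r.
  by rewrite -(ph_map k); symmetry; apply: comp_idl.
pose from r : hom z r := @PointHom _ _ z r (pt_sec r) (pt_mapK r) (comp_idr _).
pose to r : hom r z := @PointHom _ _ r z (pt_map r) (comp_idl _) (pt_mapK r).
exists z; split; first split=> r.
- by exists (from r); split=> // k _; apply/point_hom_inj; rewrite zE.
- by exists (to r); split=> // k _; apply/point_hom_inj; rewrite zE'.
- exists (to p), (from q); apply/point_hom_inj/monoid_hom_ext => a.
  exact: hE.
Qed.

(* [inl (inl u)] is the word u, [inl (inr (u, v))] is u x v, and [inr w] is the
   class of the words of value w with at least two occurrences of x. *)
Definition words (M : monoidType) (m : M) := (M + M * M + M)%type.

(** * The monoid of words and its evaluation at [m] *)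

Section Words.
Variables (M : monoidType) (m : M).

Local Notation W := (words m).

Definition word0 (u : M) : W := inl (inl u).
Definition word1 (u v : M) : W := inl (inr (u, v)).
Definition word2 (w : M) : W := inr w.

Definition word_eval (a : W) : M :=
  match a with
  | inl (inl u) => u
  | inl (inr (u, v)) => u * m * v
  | inr w => w
  end.

(** The last branch collects the products with at least two letters x, of which only the value is
    kept. *)
Definition word_mul (a b : W) : W :=
  match a, b with
  | inl (inl u), inl (inl v) => word0 (u * v)
  | inl (inl u), inl (inr (v, w)) => word1 (u * v) w
  | inl (inr (u, v)), inl (inl w) => word1 u (v * w)
  | _, _ => word2 (word_eval a * word_eval b)
  end.

Lemma word_evalM : {morph word_eval : a b / word_mul a b >-> a * b}.
Proof. by move=> [[u|[u v]]|u] [[w|[w t]]|w] //=; rewrite !mulgA. Qed.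

Lemma word_mulA : associative word_mul.
Proof.
by move=> [[u|[u v]]|u] [[w|[w t]]|w] [[y|[y z]]|y] //=; rewrite /word0 ?mulgA.
Qed.

Lemma word_mul1w : left_id (word0 1) word_mul.
Proof. by move=> [[u|[u v]]|u] //=; rewrite /word0 /word1 /word2 mul1g. Qed.

Lemma word_mulw1 : right_id (word0 1) word_mul.
Proof. by move=> [[u|[u v]]|u] //=; rewrite /word0 /word1 /word2 mulg1. Qed.

HB.instance Definition _ := Choice.on W.
HB.instance Definition _ :=
  isMonoid.Build W word_mulA word_mul1w word_mulw1.

Lemma word_eval_monoid_morphism : monoid_morphism word_eval.
Proof. by split=> //; apply: word_evalM. Qed.

Lemma word0_monoid_morphism : monoid_morphism word0.
Proof. by []. Qed.

Definition eval_hom := monoid_hom word_eval_monoid_morphism.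
Definition word0_hom := monoid_hom word0_monoid_morphism.

Lemma word0K : (eval_hom : hom (W : Mon) M) \co word0_hom = idm (M : Mon).
Proof. exact: monoid_hom_ext. Qed.

Definition words_pt : Pt (M : Mon) := Point word0K.

Definition fibered (c : W * W) : bool := word_eval c.1 == word_eval c.2.

(* A multiplicatively closed condition satisfied by the pairs (a, ev a) and
   (ev b, b); the two disjuncts correspond to the two orders in which the
   letter x of the first and of the second component may be created. *)
Definition interleaved (c : W * W) : Prop :=
  match c with
  | (inl (inr (p, q)), inl (inr (r, s))) =>
      (exists k, q = k * m * s /\ r = p * m * k) \/
      (exists k, p = r * m * k /\ s = k * m * q)
  | _ => True
  end.

(** An upper bound for the submonoid generated by the pairs (a, ev a) and (ev b, b). The fibre
    condition is what makes [interleaved] stable under products. *)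
Definition reachable (c : W * W) : bool := fibered c && `[< interleaved c >].

Lemma fibered_closed : monoid_closed fibered.
Proof.
split; first exact/eqP.
move=> c d /eqP cE /eqP dE; apply/eqP => /=.
by rewrite !word_evalM cE dE.
Qed.

(** Only products with exactly one x in each component matter. If both letters come from the same
    factor, the other factor is a pair of equal elements of [M] and the old [k] still works. *)
Lemma interleavedM (c d : W * W) :
  fibered c -> fibered d -> interleaved c -> interleaved d ->
  interleaved (c * d).
Proof.
case: c d => [c1 c2] [d1 d2] /eqP + /eqP.
case: c1 c2 => [[a|[a b]]|a] [[a'|[a' b']]|a'] //;
case: d1 d2 => [[d|[d e]]|d] [[d'|[d' e']]|d'] //= E1 E2 H1 H2.
- case: H2 => -[k [-> ->]]; [left|right]; exists k; rewrite ?E1 ?mulgA //.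
(* When the letters come from different factors, [k] is the product of what follows the earlier x
   and what precedes the later one. *)
- right; exists (b' * d); rewrite E1 -E2 !mulgA //.
- left; exists (b * d'); rewrite -E1 E2 !mulgA //.
- case: H1 => -[k [-> ->]]; [left|right]; exists k; rewrite ?E2 ?mulgA //.
Qed.

Lemma reachable_closed : monoid_closed reachable.
Proof.
split; first by rewrite unfold_in; apply/andP; split; [exact/eqP|exact/asboolP].
move=> c d /andP[cF /asboolP cI] /andP[dF /asboolP dI]; apply/andP; split.
  exact: fibered_closed.2.
exact/asboolP/interleavedM.
Qed.

Lemma reachable_diag (u : M) : reachable (word0 u, word0 u).
Proof. by apply/andP; split; [exact/eqP|exact/asboolP]. Qed.

Lemma reachable_left (a : W) : reachable (a, word0 (word_eval a)).
Proof.
by apply/andP; split; [exact/eqP|apply/asboolP; case: a => [[?|[]]|]].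
Qed.

Lemma reachable_right (a : W) : reachable (word0 (word_eval a), a).
Proof. by apply/andP; split; [exact/eqP|exact/asboolP]. Qed.

(** Once all four outer words are 1, both disjuncts say that [k] is a two-sided inverse of [m]. *)
Lemma reachable_xx :
  reachable (word1 1 1, word1 1 1) -> exists n, n * m = 1 /\ m * n = 1.
Proof.
by move=> /andP[_ /asboolP/= [] [k []]]; rewrite !(mulg1, mul1g) => e1 e2;
  exists k.
Qed.

Lemma reachable_fibered (c : W * W) : reachable c -> fibered c.
Proof. by case/andP. Qed.

Lemma fibered_diag (u : M) : fibered (word0 u, word0 u).
Proof. exact: reachable_fibered (reachable_diag u). Qed.

(** * Points over [M] carried by submonoids of [W * W] *)

Section Subpoint.
Variables (D : pred (W * W)) (closedD : monoid_closed D).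
Hypotheses (D_diag : forall u, D (word0 u, word0 u)).

Local Notation S := (submonoid closedD).

Definition sub_eval : UMagmaMorphism.type S M :=
  eval_hom \o (fst \o (val : S -> W * W)).

Definition sub_diag : UMagmaMorphism.type M S :=
  lift_hom closedD (D_diag : forall u, D (pair_hom word0_hom word0_hom u)).

Lemma sub_diagK : (sub_eval : hom (S : Mon) M) \co sub_diag = idm (M : Mon).
Proof. exact: monoid_hom_ext. Qed.

Definition sub_pt : Pt (M : Mon) := Point sub_diagK.

Lemma sub_lift_map (t : Pt (M : Mon))
    (h : UMagmaMorphism.type (pt_ob t) (W * W)%type) (hD : forall x, D (h x)) :
  (forall x, word_eval (h x).1 = pt_map t x) ->
  pt_map sub_pt \co (lift_hom closedD hD : hom (pt_ob t) (S : Mon)) = pt_map t.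
Proof. by move=> hE; apply: monoid_hom_ext. Qed.

Lemma sub_lift_sec (t : Pt (M : Mon))
    (h : UMagmaMorphism.type (pt_ob t) (W * W)%type) (hD : forall x, D (h x)) :
  (forall u, h (pt_sec t u) = (word0 u, word0 u)) ->
  (lift_hom closedD hD : hom (pt_ob t) (S : Mon)) \co pt_sec t = pt_sec sub_pt.
Proof. by move=> hE; apply: monoid_hom_ext => u; apply/val_inj/hE. Qed.

Definition sub_lift (t : Pt (M : Mon))
    (h : UMagmaMorphism.type (pt_ob t) (W * W)%type)
    (hD : forall x, D (h x)) (hE : forall x, word_eval (h x).1 = pt_map t x)
    (hs : forall u, h (pt_sec t u) = (word0 u, word0 u)) : hom t sub_pt :=
  @PointHom _ _ t sub_pt _ (sub_lift_map hD hE) (sub_lift_sec hD hs).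

Definition left_hom : UMagmaMorphism.type W (W * W)%type :=
  pair_hom idfun (word0_hom \o eval_hom).

Definition right_hom : UMagmaMorphism.type W (W * W)%type :=
  pair_hom (word0_hom \o eval_hom) idfun.

Definition sub_left (D_left : forall a, D (left_hom a)) : hom words_pt sub_pt :=
  @sub_lift words_pt left_hom D_left (fun=> erefl) (fun=> erefl).

Definition sub_right (D_right : forall a, D (right_hom a)) :
  hom words_pt sub_pt :=
  @sub_lift words_pt right_hom D_right (fun=> erefl) (fun=> erefl).

End Subpoint.

(** The fibre product of [W] with itself over [M]. *)
Definition pullback : Pt (M : Mon) := sub_pt fibered_closed fibered_diag.

Definition reachable_pt : Pt (M : Mon) :=
  sub_pt reachable_closed reachable_diag.

Definition reachable_incl : hom reachable_pt pullback :=
  @sub_lift _ fibered_closed fibered_diag reachable_pt val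
    (fun c => reachable_fibered (valP c)) (fun=> erefl) (fun=> erefl).

Lemma pullback_fst_map :
  (eval_hom : hom (W : Mon) M) \co
    (fst \o val : UMagmaMorphism.type (pt_ob pullback) W) = pt_map pullback.
Proof. exact: monoid_hom_ext. Qed.

Lemma pullback_fst_sec :
  ((fst \o val : UMagmaMorphism.type (pt_ob pullback) W) :
    hom (pt_ob pullback) (W : Mon)) \co pt_sec pullback = word0_hom.
Proof. exact: monoid_hom_ext. Qed.

(** The structure map reads the first component, so the fibre condition is used here. *)
Lemma pullback_snd_map :
  (eval_hom : hom (W : Mon) M) \co
    (snd \o val : UMagmaMorphism.type (pt_ob pullback) W) = pt_map pullback.
Proof. by apply: monoid_hom_ext => c /=; rewrite (eqP (valP c)). Qed.

Lemma pullback_snd_sec :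
  ((snd \o val : UMagmaMorphism.type (pt_ob pullback) W) :
    hom (pt_ob pullback) (W : Mon)) \co pt_sec pullback = word0_hom.
Proof. exact: monoid_hom_ext. Qed.

Definition pullback_fst : hom pullback words_pt :=
  @PointHom _ _ pullback words_pt _ pullback_fst_map pullback_fst_sec.

Definition pullback_snd : hom pullback words_pt :=
  @PointHom _ _ pullback words_pt _ pullback_snd_map pullback_snd_sec.

Lemma pullback_product : is_product pullback_fst pullback_snd.
Proof.
move=> t f g.
have fE x : word_eval (ph_hom f x) = pt_map t x.
  by exact: monoid_hom_congr (ph_map f) x.
have gE x : word_eval (ph_hom g x) = pt_map t x.
  by exact: monoid_hom_congr (ph_map g) x.
have fsE u : ph_hom f (pt_sec t u) = word0 u.
  by exact: monoid_hom_congr (ph_sec f) u.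
have gsE u : ph_hom g (pt_sec t u) = word0 u.
  by exact: monoid_hom_congr (ph_sec g) u.
have fgF x : fibered (pair_hom (ph_hom f) (ph_hom g) x).
  by apply/eqP; rewrite /= fE gE.
have fgs u : pair_hom (ph_hom f) (ph_hom g) (pt_sec t u) = (word0 u, word0 u).
  by rewrite /= fsE gsE.
exists (sub_lift fibered_closed fibered_diag fgF fE fgs); split.
  by split; apply/point_hom_inj/monoid_hom_ext.
move=> k [kf kg]; apply/point_hom_inj/monoid_hom_ext => x; apply: val_inj.
suff : (ph_hom f x, ph_hom g x) = val (ph_hom k x) by [].
by rewrite -kf -kg /=; case: (val _).
Qed.

Lemma reachable_incl_mono : is_mono reachable_incl.
Proof.
move=> t g h gh; apply/point_hom_inj/monoid_hom_ext => x; apply: val_inj.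
by have /(congr1 val) := monoid_hom_congr (congr1 (@ph_hom _ _ _ _) gh) x.
Qed.

Lemma maltsev_inverse :
  maltsev_object (M : Mon) -> exists n, n * m = 1 /\ m * n = 1.
Proof.
have Rf := reachable_fibered; case=> _ _ /(_ _ _ _ _ _ pullback_product).
(* These are the product inclusions a |-> (a, ev a) and b |-> (ev b, b); both factor through
   [reachable_incl]. *)
move=> /(_ (sub_left _ _ (fun a => Rf _ (reachable_left a)))
           (sub_right _ _ (fun a => Rf _ (reachable_right a)))) jse.
have [||||||g [_ gK]] := jse _ _ _ _ _ _ reachable_incl_mono.
- exact/point_hom_inj/monoid_hom_ext.
- by apply: is_zero_hom_section.
- by apply: is_zero_hom_section.
- exact/point_hom_inj/monoid_hom_ext.
- exists (sub_left _ _ reachable_left).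
  by apply/point_hom_inj/monoid_hom_ext => x; apply: val_inj.
- exists (sub_right _ _ reachable_right).
  by apply/point_hom_inj/monoid_hom_ext => x; apply: val_inj.
have xxF : fibered (word1 1 1, word1 1 1) by exact/eqP.
pose xx : pt_ob pullback := exist _ (word1 1 1, word1 1 1) xxF.
(* By [gK], the inverse [g] of the inclusion preserves the underlying pair, so (x, x) is
   reachable. *)
apply: reachable_xx; have <- : val (ph_hom g xx) = (word1 1 1, word1 1 1).
  by have /(congr1 val) := monoid_hom_congr (congr1 (@ph_hom _ _ _ _) gK) xx.
exact: valP.
Qed.

End Words.

Theorem theorem6p14 (M : monoidType) :
  maltsev_object (M : Mon) -> is_group M.
Proof.
(* The monoid [words m] changes with [m], so inverses arise one element at a time and are assembled
   by choice. *)
move=> mM; have /choice[inv invP] := fun m : M => maltsev_inverse m mM.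
by exists inv; split=> m; case: (invP m).
Qed.
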